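(* Let $r\ge1$, let $\mathbf{n}=(n_1,\ldots,n_r)$ be a vector of positive integers, $n=n_1+\cdots+n_r$, and let $\boldsymbol{\alpha}=(\alpha_1,\ldots,\alpha_r)$ be real with $\alpha_j>-1$ for $j=1,\ldots,r$. (i) If $\beta>-1$, then all zeros of the Jacobi–Piñeiro polynomial $P_{\mathbf{n}}^{(\boldsymbol{\alpha},\beta)}$ lie in $(0,1)$. (ii) If $-2<\beta\le-1$, then all zeros of $P_{\mathbf{n}}^{(\boldsymbol{\alpha},\beta)}$ but one lie in $(0,1)$, and the remaining zero lies in $[1,\infty)$.
   Context: $(b)_k=b(b+1)\cdots(b+k-1)$, $(b)_0=1$, is the Pochhammer symbol. The Jacobi–Piñeiro polynomial is defined (for canonical as well as non-canonical parameter values) by $$P_{\mathbf{n}}^{(\boldsymbol{\alpha},\beta)}(x)=\frac{(-1)^n\prod_{j=1}^r(\alpha_j+1)_{n_j}}{\prod_{j=1}^r(n+\alpha_j+\beta+1)_{n_j}}\,(1-x)^{-\beta}\;{}_{r+1}F_r\!\left(\begin{array}{c}-n-\beta,\,\alpha_1+n_1+1,\ldots,\alpha_r+n_r+1\\ \alpha_1+1,\ldots,\alpha_r+1\end{array}\Big|\,x\right),$$ where ${}_{r+1}F_r\!\left(\begin{array}{c}a_0,\ldots,a_r\\ b_1,\ldots,b_r\end{array}\Big|\,x\right)=\sum_{k\ge0}\frac{(a_0)_k\cdots(a_r)_k}{(b_1)_k\cdots(b_r)_k\,k!}x^k$. The right-hand side is a polynomial in $x$ of degree at most $n$ (the identity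 is understood as one of power series at $0$). Zeros are counted with multiplicity. No condition $\alpha_i-\alpha_j\notin\mathbb{Z}$ is imposed.
   Formalization: In (ii), when n = 1 (so r = 1, n_1 = 1), the formal theorem also assumes α_1+β+2 > 0; otherwise P is undefined (α_1+β+2 = 0) or its only zero (α_1+1)/(α_1+β+2) is negative, e.g. α_1 = -1/2, β = -19/10 gives -5/4. *)

(* Defs.v *)
From HB Require Import structures.
From mathcomp Require Import all_boot all_order all_algebra.
From mathcomp Require Import reals.
From mathcomp Require Import complex.
From mathcomp Require Import zify ring lra.

Set Implicit Arguments.
Unset Strict Implicit.
Unset Printing Implicit Defensive.

Import Order.TTheory GRing.Theory Num.Theory.
Local Open Scope ring_scope.

(* Power series at 0 are represented by their coefficient sequences. *)

Definition pochhammer (R : pzRingType) (b : R) (k : nat) : R :=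
  \prod_(i < k) (b + i%:R).

(* k-th coefficient of the hypergeometric series with numerator parameters [a]
   and denominator parameters [b]; the factor k! is not part of [b]. *)
Definition hypergeom_coef (R : fieldType) (a b : seq R) (k : nat) : R :=
  (\prod_(c <- a) pochhammer c k) /
  ((\prod_(c <- b) pochhammer c k) * k`!%:R).

(* k-th coefficient of (1 - x)^c, i.e. binomial(c, k) (-1)^k = (-c)_k / k!. *)
Definition one_sub_pow_coef (R : fieldType) (c : R) (k : nat) : R :=
  pochhammer (- c) k / k`!%:R.

Definition cauchy_product (R : pzRingType) (f g : nat -> R) (m : nat) : R :=
  \sum_(k < m.+1) f k * g (m - k)%N.

Section JacobiPineiro.

Variables (R : fieldType) (r : nat) (nn : 'I_r -> nat) (alpha : 'I_r -> R).
Variable beta : R.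

Let n := (\sum_(j < r) nn j)%N.

Definition JP_factor : R :=
  (-1) ^+ n * (\prod_(j < r) pochhammer (alpha j + 1) (nn j)) /
  \prod_(j < r) pochhammer (n%:R + alpha j + beta + 1) (nn j).

Definition JP_coef (m : nat) : R :=
  JP_factor *
  cauchy_product
    (one_sub_pow_coef (- beta))
    (hypergeom_coef
       (- n%:R - beta :: [seq alpha j + (nn j)%:R + 1 | j : 'I_r])
       [seq alpha j + 1 | j : 'I_r])
    m.

(* The coefficients of index > n vanish: see [JP_coef_gt] and
   [coef_jacobi_pineiro] below. *)
Definition jacobi_pineiro : {poly R} := \poly_(m < n.+1) JP_coef m.

End JacobiPineiro.

(* [s] lists the complex zeros of the real polynomial [p], each repeated
   according to its multiplicity. *)
Definition zeros_with_mult (R : rcfType) (p : {poly R}) (s : seq R[i]) : Prop :=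
  let pC := map_poly (real_complex R) p in
  pC != 0 /\ pC = lead_coef pC *: \prod_(z <- s) ('X - z%:P).

Section Vanishing.

Variable R : numFieldType.
Implicit Types (a b : R) (Q : {poly R}).

Lemma pochhammer0 a : pochhammer a 0 = 1.
Proof. exact: big_ord0. Qed.

Lemma pochhammerS a k : pochhammer a k.+1 = a * pochhammer (a + 1) k.
Proof.
rewrite /pochhammer big_ord_recl addr0; congr (_ * _).
by apply: eq_bigr => i _; rewrite -addrA -natr1 [1 + _]addrC.
Qed.

Lemma pochhammerD a k l :
  pochhammer a (k + l) = pochhammer a k * pochhammer (a + k%:R) l.
Proof.
rewrite /pochhammer big_split_ord /=; congr (_ * _).
by apply: eq_bigr => i _; rewrite natrD addrA.
Qed.

Let c a k := pochhammer a k / k`!%:R.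

Let cS a k : k.+1%:R * c a k.+1 = a * c (a + 1) k.
Proof.
rewrite /c pochhammerS factS natrM invfM.
have h : k.+1%:R != 0 :> R by rewrite pnatr_eq0.
have h' : k`!%:R != 0 :> R by rewrite pnatr_eq0 -lt0n fact_gt0.
by field; rewrite h' addrC natr1 h.
Qed.

Let sumk a b m (G : nat -> R) :
  \sum_(k < m.+2) k%:R * G k * (c a k * c b (m.+1 - k)%N) =
  a * \sum_(k < m.+1) G k.+1 * (c (a + 1) k * c b (m - k)%N).
Proof.
rewrite big_ord_recl !mul0r add0r big_distrr /=; apply: eq_bigr => i _.
rewrite /bump /= add1n subSS.
transitivity (G i.+1 * c b (m - i)%N * (i.+1%:R * c a i.+1)); first by ring.
by rewrite cS; ring.
Qed.

Lemma vandermonde_pochhammer a b m :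
  \sum_(k < m.+1) c a k * c b (m - k)%N = c (a + b) m.
Proof.
elim: m a b => [|m IHm] a b.
  by rewrite big_ord1 /c !pochhammer0 fact0 divr1 mulr1.
have h : m.+1%:R != 0 :> R by rewrite pnatr_eq0.
apply: (mulfI h); rewrite cS.
have -> : m.+1%:R * (\sum_(k < m.+2) c a k * c b (m.+1 - k)%N) =
   \sum_(k < m.+2) k%:R * 1 * (c a k * c b (m.+1 - k)%N) +
   \sum_(k < m.+2) k%:R * 1 * (c b k * c a (m.+1 - k)%N).
  rewrite [X in _ = _ + X](reindex_inj rev_ord_inj) -big_split big_distrr /=.
  apply: eq_bigr => i _; rewrite subSS.
  have hi : (i <= m.+1)%N by rewrite -ltnS.
  by rewrite subKn // natrB //; ring.
rewrite (sumk a b m (fun=> 1)) (sumk b a m (fun=> 1)).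
under eq_bigr do rewrite mul1r.
rewrite IHm; under eq_bigr do rewrite mul1r.
by rewrite IHm !(addrAC _ 1) [b + a]addrC; ring.
Qed.

Lemma cauchy_product_poly_eq0 (n : nat) a b Q m :
  a + b = - n%:R -> (size Q <= n.+1)%N -> (n < m)%N ->
  \sum_(k < m.+1) Q.[k%:R] * (c a k * c b (m - k)%N) = 0.
Proof.
elim: n a b Q m => [|n IHn] a b Q [//|m] hab hQ hm.
  rewrite (size1_polyC hQ).
  under eq_bigr do rewrite hornerC.
  by rewrite -big_distrr /= vandermonde_pochhammer hab /c pochhammerS oppr0
             !mul0r mulr0.
have [Q1 [q0 ->] hQ1] :
    exists2 Q1, (exists q0, Q = Q1 * 'X + q0%:P) & (size Q1 <= n.+1)%N.
  elim/poly_ind: Q hQ => [|Q1 q0 _] hQ.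
    by exists 0; [exists 0; rewrite mul0r addr0 | rewrite size_poly0].
  exists Q1; first by exists q0.
  by move: hQ; rewrite size_MXaddC; case: ifP => // /andP[/eqP-> _]; rewrite size_poly0.
transitivity
   (\sum_(k < m.+2) k%:R * Q1.[k%:R] * (c a k * c b (m.+1 - k)%N)
    + q0 * \sum_(k < m.+2) c a k * c b (m.+1 - k)%N).
  rewrite big_distrr -big_split /=; apply: eq_bigr => i _.
  by rewrite hornerMXaddC mulrDl mulrA [_ * i%:R]mulrC !mulrA.
rewrite (sumk a b m (fun k => Q1.[k%:R])) vandermonde_pochhammer hab.
have -> : c (- n.+1%:R) m.+1 = 0.
  rewrite /c; have -> : m.+1 = (n.+1 + (m - n.+1).+1)%N by move: hm; lia.
  by rewrite pochhammerD addNr [pochhammer 0 _]pochhammerS !mul0r mulr0 mul0r.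
rewrite mulr0 addr0.
have -> : \sum_(k < m.+1) Q1.[k.+1%:R] * (c (a + 1) k * c b (m - k)%N)
   = \sum_(k < m.+1) (Q1 \Po ('X + 1%:P)).[k%:R] * (c (a + 1) k * c b (m - k)%N).
  by apply: eq_bigr => i _; rewrite horner_comp !hornerE natr1.
rewrite IHn ?mulr0 //.
  by rewrite addrAC hab -natr1; ring.
by rewrite -[1%:P]opprK -polyCN size_comp_poly2 // size_XsubC.
Qed.

Lemma JP_coef_gt (r : nat) (nn : 'I_r -> nat) (alpha : 'I_r -> R) beta m :
  (forall j, -1 < alpha j) -> (\sum_(j < r) nn j < m)%N ->
  JP_coef nn alpha beta m = 0.
Proof.
move=> ha hm; rewrite /JP_coef; set n := (\sum_(j < r) nn j)%N in hm *.
pose Q := \prod_(j < r) ((pochhammer (alpha j + 1) (nn j))^-1 *: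
             \prod_(i < nn j) ('X - (- (alpha j + 1 + i%:R))%:P)).
have poch_neq0 j k : pochhammer (alpha j + 1) k != 0.
  apply/prodf_neq0 => i _; rewrite gt_eqF // ltr_wpDr ?ler0n //.
  by rewrite -ltrBlDr sub0r.
have sQ : (size Q <= n.+1)%N.
  have -> : size Q = (\sum_(j < r) nn j).+1; last by [].
  rewrite size_prod => [|j _]; last first.
    by rewrite scaler_eq0 invr_eq0 (negPf (poch_neq0 _ _)) monic_neq0 ?monic_prod_XsubC.
  have hcard k : size (index_enum 'I_k) = k.
    by rewrite /index_enum -enumT size_enum_ord.
  under eq_bigr => j _ do
    rewrite size_scale ?invr_eq0 ?poch_neq0 // size_prod_XsubC [size _]hcard -addn1.
  by rewrite big_split /= sum1_card -addSn addnK.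
have hQ k : Q.[k%:R] = \prod_(j < r)
    (pochhammer (alpha j + (nn j)%:R + 1) k / pochhammer (alpha j + 1) k).
  rewrite horner_prod; apply: eq_bigr => j _.
  rewrite hornerZ horner_prod.
  have -> : \prod_(i < nn j) ('X - (- (alpha j + 1 + i%:R))%:P).[k%:R]
          = pochhammer (alpha j + 1 + k%:R) (nn j).
    by apply: eq_bigr => i _; rewrite !hornerE /=; ring.
  apply: (mulfI (poch_neq0 j (nn j))); rewrite mulVKf //.
  apply: (mulfI (poch_neq0 j k)).
  rewrite -pochhammerD addnC pochhammerD [in RHS]mulrCA; congr (_ * _).
  by rewrite [RHS]mulrC divfK // addrAC.
suff -> : cauchy_product (one_sub_pow_coef (- beta))
    (hypergeom_coef
       (- n%:R - beta :: [seq alpha j + (nn j)%:R + 1 | j : 'I_r])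
       [seq alpha j + 1 | j : 'I_r]) m
  = \sum_(k < m.+1) Q.[k%:R] * (c (- n%:R - beta) k * c beta (m - k)%N).
  by rewrite (cauchy_product_poly_eq0 (n := n)) ?mulr0 // subrK.
rewrite /cauchy_product (reindex_inj rev_ord_inj) /=; apply: eq_bigr => i _.
have hi : (i <= m)%N by rewrite -ltnS.
rewrite subSS subKn // /one_sub_pow_coef opprK -/(c _ _) hQ /hypergeom_coef.
rewrite big_cons !big_image /= prodf_div invfM /c.
by ring.
Qed.

Lemma coef_jacobi_pineiro (r : nat) (nn : 'I_r -> nat) (alpha : 'I_r -> R) beta m :
  (forall j, -1 < alpha j) ->
  (jacobi_pineiro nn alpha beta)`_m = JP_coef nn alpha beta m.
Proof.
move=> ha; rewrite coef_poly ltnS; case: leqP => // hm.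
by rewrite JP_coef_gt.
Qed.

End Vanishing.

(* Main.v *)
Require Import Defs.
From mathcomp Require Import all_boot all_order all_algebra.
From mathcomp Require Import reals.
From mathcomp Require Import complex.
From mathcomp Require Import polyrcf.
From mathcomp Require Import ring lra.

Import Order.TTheory GRing.Theory Num.Theory.
Local Open Scope ring_scope.
Local Open Scope complex_scope.

(** Let [theta = x d/dx].  Since [(a + m)_k / (a)_k = (a + k)_m / (a)_m], the
    hypergeometric series in the definition of the Jacobi-Pineiro polynomial is,
    up to a nonzero constant, the product of the first-order operators
    [theta + c] applied to [(1 - x)^(n + beta)], where [c] runs over the [n]
    positive numbers [alpha_j + i], [1 <= i <= n_j].  This is a form of the
    Rodrigues formula.  One factor at a time, it reads
      [(theta + c) ((1 - x)^b p) = (1 - x)^(b - 1) (jp_step b c p)],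
    so the polynomial is a nonzero multiple of the result of [n] successive
    steps [jp_step b c] applied to [1], with [b] going down from [beta + n] to
    [beta + 1] ([jacobi_pineiro_iter]).

    Suppose that [c > 0] and that [p] is monic with simple zeros
    [z_1 < ... < z_k], all of them in (0,1), and let [q = jp_step b c p].  Then
    [q 0 = c p(0)] and [q z_i = z_i (1 - z_i) p'(z_i)], so [q] alternates in
    sign along [0, z_1, ..., z_k], and it is positive at the last of these
    points ([jp_step_sign_change]).  Moreover [q 1 = - b p(1)].  If [b > 0],
    there is one more sign change on the way to [1], and [q], of degree at most
    [k + 1], has [k + 1] simple zeros in (0,1) ([jp_step_roots]).  If
    [b <= 0], the [k] sign changes already found leave a single further zero
    [y], which is real; if moreover [k + c + b > 0], the leading coefficient
    [- (k + c + b)] of [q] is negative while [q 1] is nonnegative, so [y >= 1]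
    ([jp_step_roots_le0]).

    When [beta > -1], every step has [b > 0].  When [-2 < beta <= -1], only the
    last one, where [b = beta + 1] and [k = n - 1], does not; there
    [k + c + b > 0] is automatic for [n >= 2], and for [n = 1] it says that
    [alpha_1 + beta + 2 > 0]. *)

(** * Elementary steps *)

(** The polynomial factor of [(x d/dx + c) ((1 - x)^b p)], once [(1 - x)^(b - 1)]
    is taken out. *)
Definition jp_step {R : nzRingType} (b c : R) (p : {poly R}) : {poly R} :=
  (1 - 'X) * ('X * p^`() + c *: p) - b *: ('X * p).

(** The polynomial [Q] such that the product of the [x d/dx + c], [c] in [cs],
    maps [(1 - x)^(beta + size cs)] to [(1 - x)^beta Q]. *)
Fixpoint jp_iter {R : nzRingType} (cs : seq R) (beta : R) : {poly R} :=
  if cs is c :: cs' then jp_step (beta + 1) c (jp_iter cs' (beta + 1)) else 1.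

Lemma coef_jp_step {R : comNzRingType} (b c : R) (p : {poly R}) m :
  (jp_step b c p)`_m =
  (m%:R + c) * p`_m - (if m is k.+1 then (k%:R + c + b) * p`_k else 0).
Proof.
have E k : ('X * p^`() + c *: p)`_k = (k%:R + c) * p`_k.
  rewrite coefD coefXM coefZ; case: k => [|k] /=; first by rewrite !add0r.
  by rewrite coef_deriv mulrDl mulr_natl.
rewrite /jp_step mulrBl mul1r coefB coefB coefZ !coefXM E.
case: m => [|m] /=; first by rewrite mulr0 !subr0.
by rewrite E [(_ + b) * _]mulrDl opprD addrA.
Qed.

Lemma jp_stepZ {R : comNzRingType} (b c a : R) (p : {poly R}) :
  jp_step b c (a *: p) = a *: jp_step b c p.
Proof.
by apply/polyP => -[|m]; rewrite coefZ !coef_jp_step !coefZ; ring.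
Qed.

Lemma size_jp_step {R : comNzRingType} (b c : R) (p : {poly R}) :
  (size (jp_step b c p) <= (size p).+1)%N.
Proof.
apply/leq_sizeP => -[|m] hm //; rewrite coef_jp_step.
by rewrite !(nth_default 0) ?mulr0 ?subrr // ltnW.
Qed.

(** * The polynomial as an iterated step *)

Lemma pochhammerSr {R : pzRingType} (a : R) k :
  pochhammer a k.+1 = pochhammer a k * (a + k%:R).
Proof. exact: big_ord_recr. Qed.

(** [(1 - x) f' = a f] for [f = (1 - x)^(-a)]. *)
Lemma one_sub_pow_coefS {R : numFieldType} (a : R) k :
  k.+1%:R * one_sub_pow_coef (- a) k.+1 = (a + k%:R) * one_sub_pow_coef (- a) k.
Proof.
rewrite /one_sub_pow_coef opprK pochhammerSr factS natrM invfM.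
have h : k.+1%:R != 0 :> R by rewrite pnatr_eq0.
have h' : k`!%:R != 0 :> R by rewrite pnatr_eq0 -lt0n fact_gt0.
by field; rewrite h' addrC natr1 h.
Qed.

(** [(1 - x)^(-a) = (1 - x) (1 - x)^(-(a + 1))]. *)
Lemma one_sub_pow_coefB {R : numFieldType} (a : R) k :
  one_sub_pow_coef (- a) k.+1 =
  one_sub_pow_coef (- (a + 1)) k.+1 - one_sub_pow_coef (- (a + 1)) k.
Proof.
have h : k.+1%:R != 0 :> R by rewrite pnatr_eq0.
apply: (mulfI h); rewrite mulrBr one_sub_pow_coefS.
suff E : a * one_sub_pow_coef (- (a + 1)) k = (a + k%:R) * one_sub_pow_coef (- a) k.
  by rewrite one_sub_pow_coefS -E -natr1; ring.
rewrite /one_sub_pow_coef !opprK !mulrA; congr (_ / _).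
by rewrite -pochhammerS pochhammerSr mulrC.
Qed.

(** If the power series [h] is [(1 - x)^(beta + 1) p], then [x h' + c h] is
    [(1 - x)^beta (jp_step (beta + 1) c p)]. *)
Lemma cauchy_product_step {R : numFieldType} (beta c : R) (h : nat -> R)
    (p : {poly R}) :
  (forall m, cauchy_product (one_sub_pow_coef (- (beta + 1))) h m = p`_m) ->
  forall m, cauchy_product (one_sub_pow_coef (- beta))
              (fun k => (k%:R + c) * h k) m = (jp_step (beta + 1) c p)`_m.
Proof.
move=> hp [|m]; rewrite coef_jp_step -!hp /cauchy_product.
  by rewrite !big_ord1 /= /one_sub_pow_coef !pochhammer0 subnn; ring.
rewrite big_ord_recl [in RHS]big_ord_recl mulrDr 2!big_distrr /= -addrA -sumrB.
congr (_ + _).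
  by rewrite /one_sub_pow_coef !pochhammer0 !subn0; ring.
apply: eq_bigr => -[i /= hi] _; rewrite /bump /= add1n subSS.
have := one_sub_pow_coefS (beta + 1) i.
rewrite (one_sub_pow_coefB beta) natrB // -!natr1 => E.
set B1 := one_sub_pow_coef _ i.+1 in E *; set B0 := one_sub_pow_coef _ i in E *.
have {}E : i%:R * B1 = (beta + 1 + i%:R) * B0 - B1 by rewrite -E; ring.
(* The index [m - i] of [h] is split so that [i * B1] can be replaced by means
   of [E]. *)
transitivity (((m%:R + c) * B1 - i%:R * B1 - (m%:R + c) * B0
              + i%:R * B0) * h (m - i)%N);
  first by ring.
by rewrite E; ring.
Qed.

Lemma cauchy_product_jp_iter {R : numFieldType} (cs : seq R) (beta : R) m :
  cauchy_product (one_sub_pow_coef (- beta))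
    (fun k => (\prod_(c <- cs) (k%:R + c)) *
              one_sub_pow_coef (beta + (size cs)%:R) k) m
  = (jp_iter cs beta)`_m.
Proof.
elim: cs beta m => [|c cs IH] beta m /=.
  rewrite coef1 /cauchy_product /one_sub_pow_coef addr0 opprK.
  under eq_bigr do rewrite big_nil mul1r.
  rewrite vandermonde_pochhammer subrr; case: m => [|m].
    by rewrite pochhammer0 fact0 divr1.
  by rewrite pochhammerS !mul0r.
rewrite -(cauchy_product_step _ _ _ _ (IH (beta + 1))).
apply: eq_bigr => i _; congr (_ * _); rewrite big_cons -mulrA; congr (_ * (_ * _)).
by rewrite -natr1 addrA addrAC.
Qed.

(** The numbers [alpha_j + i], [1 <= i <= n_j], listed with repetitions. *)
Definition jp_shifts {R : pzRingType} {r : nat} (nn : 'I_r -> nat)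
    (alpha : 'I_r -> R) : seq R :=
  [seq alpha j + 1 + i%:R | j <- enum 'I_r, i <- iota 0 (nn j)].

Lemma size_jp_shifts {R : pzRingType} {r : nat} (nn : 'I_r -> nat)
    (alpha : 'I_r -> R) : size (jp_shifts nn alpha) = (\sum_(j < r) nn j)%N.
Proof.
rewrite size_allpairs_dep sumnE big_map big_enum /=.
by under eq_bigr do rewrite size_iota.
Qed.

Lemma prod_jp_shifts {R : comPzRingType} {r : nat} (nn : 'I_r -> nat)
    (alpha : 'I_r -> R) (x : R) :
  \prod_(c <- jp_shifts nn alpha) (x + c)
  = \prod_(j < r) pochhammer (alpha j + 1 + x) (nn j).
Proof.
rewrite big_allpairs_dep big_enum /=; apply: eq_bigr => j _.
rewrite -{1}(subn0 (nn j)) -/(index_iota 0 (nn j)) big_mkord.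
by apply: eq_bigr => i _; ring.
Qed.

(** The Rodrigues formula. The condition on [alpha] keeps the denominators
    [(alpha_j + 1)_k] of the hypergeometric series away from 0. *)
Lemma jacobi_pineiro_iter {R : numFieldType} {r : nat} (nn : 'I_r -> nat)
    (alpha : 'I_r -> R) (beta : R) (halpha : forall j, -1 < alpha j) :
  jacobi_pineiro nn alpha beta =
  ((-1) ^+ (\sum_(j < r) nn j)%N /
   \prod_(j < r) pochhammer ((\sum_(j < r) nn j)%:R + alpha j + beta + 1) (nn j))
  *: jp_iter (jp_shifts nn alpha) beta.
Proof.
have poch_neq0 j k : pochhammer (alpha j + 1) k != 0.
  apply/prodf_neq0 => i _; rewrite gt_eqF // ltr_wpDr ?ler0n //.
  by rewrite -ltrBlDr sub0r.
apply/polyP => m; rewrite coef_jacobi_pineiro // coefZ -cauchy_product_jp_iter.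
rewrite /JP_coef /JP_factor size_jp_shifts.
set n := (\sum_(j < r) nn j)%N; set D := \prod_(j < r) pochhammer (_ + beta + 1) _.
set N := \prod_(j < r) pochhammer (alpha j + 1) _.
have N0 : N != 0 by apply/prodf_neq0.
rewrite [_ * N / D]mulrAC -[_ / D * N * _]mulrA; congr (_ * _).
rewrite /cauchy_product mulr_sumr; apply: eq_bigr => i _.
rewrite mulrCA; congr (_ * _); move: (m - i)%N => k.
rewrite prod_jp_shifts /hypergeom_coef big_cons !big_image /=.
rewrite /one_sub_pow_coef opprD [- beta - _]addrC.
set M := \prod_(j in 'I_r) pochhammer (alpha j + 1) k.
have M0 : M != 0 by apply/prodf_neq0.
set A := \prod_(j in 'I_r) pochhammer (alpha j + (nn j)%:R + 1) k.
set V := \prod_(j < r) pochhammer (alpha j + 1 + k%:R) (nn j).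
have -> : V = N * A / M.
  apply: (mulIf M0); rewrite divfK // /V /N /A /M -!big_split /=.
  apply: eq_bigr => j _.
  by rewrite mulrC -pochhammerD addnC pochhammerD addrAC.
by rewrite invfM; ring.
Qed.

(** * Sign changes and zeros *)

(** [x < y] and [q] takes values of opposite strict signs at [x] and [y]. *)
Definition sign_change {R : realDomainType} (q : {poly R}) : rel R :=
  fun x y => (x < y) && (q.[x] * q.[y] < 0).

Lemma path_lt_mem {R : numDomainType} (x z : R) (s : seq R) :
  path <%R x s -> z \in s -> x < z.
Proof. by move=> /(order_path_min lt_trans)/allP; apply. Qed.

(** Each sign change of [q] yields a zero, strictly between the two points. *)
Lemma path_sign_change_roots {R : rcfType} (q : {poly R}) (x u : R) (t : seq R) :
  path (sign_change q) x t -> all (<= u) t ->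
  exists s : seq R, [/\ size s = size t, path <%R x s, all (root q) s & all (< u) s].
Proof.
elim: t x => [|y t IH] x /=; first by exists [::].
case/andP => /andP[xy qxy] ht /andP[yu tu].
have [s [ss ps rs us]] := IH y ht tu.
have [z /andP[xz zy] rz] : exists2 z, x < z < y & root q z.
  have [z] := poly_ivtoo (ltW xy) qxy.
  by rewrite in_itv; exists z.
exists (z :: s); split=> /=; rewrite ?ss ?xz ?rz ?rs ?us ?(lt_le_trans zy yu) //.
by case: (s) ps => //= w s' /andP[yw ->]; rewrite (lt_trans zy yw).
Qed.

Lemma horner_prod_XsubC_gt0 {R : numDomainType} (x : R) (s : seq R) :
  all (< x) s -> 0 < (\prod_(z <- s) ('X - z%:P)).[x].
Proof.
move=> /allP hs; rewrite horner_prod big_seq; apply: prodr_gt0 => z zs.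
by rewrite hornerXsubC subr_gt0; exact: hs.
Qed.

(** The derivative of a monic polynomial with simple real zeros alternates in sign
    at these zeros and is positive at the largest one. Hence so does any [q]
    that has the sign of [p'] at the zeros of [p], and that of [p] at a point
    [x] to their left. The positive factors are kept explicit because the
    induction, which drops the smallest zero [z], multiplies them by [w - z]. *)
Lemma prod_XsubC_sign_change {R : realFieldType} (q : {poly R}) (x : R) (s : seq R) :
  let p := \prod_(z <- s) ('X - z%:P) in
  path <%R x s ->
  (exists2 g, 0 < g & q.[x] = g * p.[x]) ->
  (forall z, z \in s -> exists2 g, 0 < g & q.[z] = g * p^`().[z]) ->
  path (sign_change q) x s /\ 0 < q.[last x s].
Proof.
elim: s x => [|z s IH] x /=.
  by move=> _ [g g0 ->] _; rewrite big_nil hornerC mulr1.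
rewrite big_cons; set p1 := \prod_(w <- s) _.
case/andP=> xz zs [g1 g10 qx] hq.
have zlt w : w \in s -> z < w by exact: path_lt_mem.
have dE w : (('X - z%:P) * p1)^`().[w] = p1.[w] + (w - z) * p1^`().[w].
  by rewrite derivM derivXsubC !hornerE.
have [g2 g20 qz] := hq z (mem_head _ _).
rewrite dE subrr mul0r addr0 in qz.
have [||hs hl] := IH z zs; first by exists g2.
  move=> w ws; have [|g g0 ->] := hq w; first by rewrite inE ws orbT.
  exists (g * (w - z)); first by rewrite mulr_gt0 ?subr_gt0 ?zlt.
  by rewrite dE (rootP _) ?add0r ?mulrA // root_prod_XsubC.
split=> //; rewrite hs andbT /sign_change xz /= qx qz hornerM hornerXsubC.
have p1xz : 0 < p1.[x] * p1.[z].
  rewrite /p1 !horner_prod -big_split big_seq /=; apply: prodr_gt0 => w ws.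
  have zw := zlt w ws; rewrite !hornerXsubC.
  by rewrite nmulr_rgt0 ?subr_lt0 // (lt_trans xz zw).
have -> : g1 * ((x - z) * p1.[x]) * (g2 * p1.[z])
   = - (g1 * g2 * (z - x) * (p1.[x] * p1.[z])) by ring.
by rewrite oppr_lt0 (mulr_gt0 _ p1xz) // !mulr_gt0 ?subr_gt0.
Qed.

(** * Effect of a step on the zeros *)

Lemma horner_jp_step {R : comNzRingType} (b c : R) (p : {poly R}) x :
  (jp_step b c p).[x] = (1 - x) * (x * p^`().[x] + c * p.[x]) - b * (x * p.[x]).
Proof. by rewrite /jp_step !hornerE. Qed.

Lemma jp_step_sign_change {R : realFieldType} (b c : R) (s : seq R) :
  let q := jp_step b c (\prod_(z <- s) ('X - z%:P)) in
  0 < c -> path <%R 0 s -> all (< 1) s ->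
  path (sign_change q) 0 s /\ 0 < q.[last 0 s].
Proof.
move=> q c0 s0 /allP s1; apply: prod_XsubC_sign_change => //.
  by exists c; rewrite // horner_jp_step !mul0r mulr0 add0r subr0 subr0 mul1r.
move=> z zs; exists ((1 - z) * z).
  by rewrite mulr_gt0 ?subr_gt0; [|exact: s1|exact: path_lt_mem s0 zs].
rewrite horner_jp_step (rootP (_ : root (\prod_(z <- s) ('X - z%:P)) z)).
  by rewrite !mulr0 addr0 subr0 mulrA.
by rewrite root_prod_XsubC.
Qed.

(** A step with positive parameters raises by one the number of simple zeros in
    (0,1) and creates no other zero. *)
Lemma jp_step_roots {R : rcfType} (b c : R) (s : seq R) :
  0 < b -> 0 < c -> path <%R 0 s -> all (< 1) s ->
  exists (a : R) (s' : seq R),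
    [/\ a != 0, size s' = (size s).+1, path <%R 0 s', all (< 1) s' &
      jp_step b c (\prod_(z <- s) ('X - z%:P)) = a *: \prod_(z <- s') ('X - z%:P)].
Proof.
move=> b0 c0 s0 s1; set q := jp_step _ _ _.
have [qs ql] := jp_step_sign_change b c s c0 s0 s1.
have q1 : q.[1] < 0.
  rewrite horner_jp_step subrr mul0r add0r mul1r oppr_lt0 mulr_gt0 //.
  exact: horner_prod_XsubC_gt0.
have l1 : last 0 s < 1.
  by have := mem_last 0 s; rewrite inE => /predU1P[->|/(allP s1)//]; exact: ltr01.
have [||s' [ss' ps' rs' us']] := path_sign_change_roots q 0 1 (rcons s 1).
- by rewrite rcons_path qs /sign_change l1 pmulr_rlt0.
- by rewrite all_rcons /= lexx; apply: sub_all s1 => z; exact: ltW.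
rewrite size_rcons in ss'.
have q0 : q != 0 by apply: contraTneq q1 => ->; rewrite horner0 ltxx.
have us : uniq s' by exact: lt_sorted_uniq (path_sorted ps').
exists (lead_coef q), s'; split=> //; first by rewrite lead_coef_eq0.
apply: all_roots_prod_XsubC; rewrite ?uniq_rootsE //.
apply/eqP; rewrite eqn_leq max_poly_roots // andbT ss'.
by apply: leq_trans (size_jp_step _ _ _) _; rewrite size_prod_XsubC.
Qed.

Lemma jp_iter_roots {R : rcfType} (cs : seq R) (beta : R) :
  -1 < beta -> all (> 0) cs ->
  exists (a : R) (s : seq R),
    [/\ a != 0, size s = size cs, path <%R 0 s, all (< 1) s &
      jp_iter cs beta = a *: \prod_(z <- s) ('X - z%:P)].
Proof.
elim: cs beta => [|c cs IH] beta b1 /=.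
  by exists 1, [::]; rewrite oner_neq0 big_nil scale1r.
case/andP=> c0 cs0.
have [||a [s [a0 ss ps us ->]]] := IH (beta + 1) => //; first lra.
have [||||a' [s' [a'0 ss' ps' us' E]]] := jp_step_roots (beta + 1) c s => //.
  lra.
exists (a * a'), s'; rewrite mulf_neq0 // ss' ss; split=> //.
by rewrite jp_stepZ E scalerA.
Qed.

(** With [b <= 0] the additional zero [y] falls in [1, +oo[; the bound on
    [size s + c + b] makes the leading coefficient negative. *)
Lemma jp_step_roots_le0 {R : rcfType} (b c : R) (s : seq R) :
  b <= 0 -> 0 < c -> 0 < (size s)%:R + c + b ->
  path <%R 0 s -> all (< 1) s ->
  exists (a y : R) (s' : seq R),
    [/\ a != 0, 1 <= y, path <%R 0 s', all (< 1) s' &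
      jp_step b c (\prod_(z <- s) ('X - z%:P))
        = a *: \prod_(z <- y :: s') ('X - z%:P)].
Proof.
move=> b0 c0 cb s0 s1; set p := \prod_(z <- s) _; set q := jp_step _ _ _.
have sp : size p = (size s).+1 by exact: size_prod_XsubC.
have [qs ql] := jp_step_sign_change b c s c0 s0 s1.
have q1 : 0 <= q.[1].
  rewrite horner_jp_step subrr mul0r add0r mul1r -mulNr mulr_ge0 ?oppr_ge0 //.
  exact/ltW/horner_prod_XsubC_gt0.
have [|s' [ss' ps' rs' us']] := path_sign_change_roots q 0 1 s qs.
  by apply: sub_all s1 => z; exact: ltW.
have us : uniq s' by exact: lt_sorted_uniq (path_sorted ps').
have qk : q`_(size s).+1 = - ((size s)%:R + c + b).
  rewrite coef_jp_step nth_default ?sp // mulr0 sub0r.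
  have /monicP := monic_prod_XsubC s xpredT id.
  by rewrite lead_coefE -/p sp /= => ->; rewrite mulr1.
have sq : size q = (size s).+2.
  apply/eqP; rewrite eqn_leq -{1}sp size_jp_step ltnNge /=.
  apply: contraTN cb => /(nth_default 0) E.
  by rewrite -oppr_lt0 -qk E ltxx.
have [|d qE] := uniq_roots_prod_XsubC rs'; first by rewrite uniq_rootsE.
set p' := \prod_(z <- s') _ in qE.
have p'm : p' \is monic by exact: monic_prod_XsubC.
have d0 : d != 0.
  by apply: contra_eq_neq sq => d0; rewrite qE d0 mul0r size_poly0.
have sd : size d = 2%N.
  move: sq; rewrite qE size_Mmonic // size_prod_XsubC ss' addnS /=.
  by rewrite -[RHS]add2n => /addIn.
have d1 : d`_1 < 0.
  have : lead_coef d = q`_(size s).+1.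
    by rewrite -(lead_coef_Mmonic d p'm) -qE lead_coefE sq.
  by rewrite lead_coefE sd qk /= => ->; rewrite oppr_lt0.
(* [d] has degree 1, hence a real zero. *)
have dE : d = d`_1 *: ('X - (- d`_0 / d`_1)%:P).
  apply/polyP => -[|[|i]]; rewrite coefZ coefB coefX coefC /=.
  - by rewrite sub0r mulNr opprK mulrC divfK // lt_eqF.
  - by rewrite subr0 mulr1.
  - by rewrite subrr mulr0 nth_default // sd.
exists d`_1, (- d`_0 / d`_1), s'; split=> //; first by rewrite lt_eqF.
  move: q1; rewrite qE hornerM {1}dE hornerZ hornerXsubC.
  rewrite pmulr_lge0 ?horner_prod_XsubC_gt0 // nmulr_rge0 // subr_le0 //.
by rewrite big_cons scalerAl -dE.
Qed.

(** * Zeros of the Jacobi-Pineiro polynomials *)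

Lemma zeros_with_mult_scale_prod {R : rcfType} (a : R) (s : seq R) :
  a != 0 ->
  zeros_with_mult (a *: \prod_(z <- s) ('X - z%:P)) [seq x%:C | x <- s].
Proof.
move=> a0; rewrite /zeros_with_mult map_poly_eq0 lead_coef_map.
have /monicP m1 := monic_prod_XsubC s xpredT id.
rewrite lead_coefZ m1 mulr1 scaler_eq0 negb_or a0 monic_neq0 ?monic_prod_XsubC //.
split=> //; rewrite map_polyZ rmorph_prod big_map /=; congr (_ *: _).
by apply: eq_bigr => z _; rewrite map_polyXsubC.
Qed.

Lemma mem_jp_shifts {R : numDomainType} {r : nat} (nn : 'I_r -> nat)
    (alpha : 'I_r -> R) c :
  c \in jp_shifts nn alpha -> exists j, alpha j + 1 <= c.
Proof.
by case/allpairsPdep => j [i [_ _ ->]]; exists j; rewrite lerDl ler0n.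
Qed.

Theorem mainTheorem8 (R : realType) (r : nat) (nn : 'I_r -> nat)
    (alpha : 'I_r -> R) (beta : R)
    (hr : (1 <= r)%N)
    (hn : forall j : 'I_r, (0 < nn j)%N)
    (halpha : forall j : 'I_r, -1 < alpha j) :
  (-1 < beta ->
     exists s : seq R,
       zeros_with_mult (jacobi_pineiro nn alpha beta) [seq x%:C | x <- s] /\
       (forall x : R, x \in s -> 0 < x < 1)) /\
  (-2 < beta -> beta <= -1 ->
     ((\sum_(j < r) nn j = 1)%N -> forall j : 'I_r, 0 < alpha j + beta + 2) ->
     exists (y : R) (s : seq R),
       zeros_with_mult (jacobi_pineiro nn alpha beta)
         (y%:C :: [seq x%:C | x <- s]) /\
       (forall x : R, x \in s -> 0 < x < 1) /\
       1 <= y).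
Proof.
set n := (\sum_(j < r) nn j)%N.
have n0 : (0 < n)%N.
  rewrite /n (bigD1 (Ordinal hr)) //=; apply: leq_trans (hn _) (leq_addr _ _).
have cs0 : all (> 0) (jp_shifts nn alpha).
  apply/allP => c /mem_jp_shifts[j]; apply: lt_le_trans.
  by have := halpha j; lra.
(* The normalizing factor vanishes by convention when one of its denominators
   does, so these have to be shown nonzero. *)
have K0 : (forall j, 0 < n%:R + alpha j + beta + 1) ->
    (-1) ^+ n / \prod_(j < r) pochhammer (n%:R + alpha j + beta + 1) (nn j) != 0.
  move=> h; rewrite mulf_neq0 ?signr_eq0 // invr_eq0; apply/prodf_neq0 => j _.
  by apply/prodf_neq0 => i _; rewrite gt_eqF // ltr_wpDr ?ler0n.
rewrite jacobi_pineiro_iter // -/n; split.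
  move=> b1; have [a [s [a0 _ s0 s1 ->]]] := jp_iter_roots _ _ b1 cs0.
  exists s; rewrite scalerA; split.
    apply: zeros_with_mult_scale_prod; rewrite mulf_neq0 // K0 // => j.
    have : 1 <= n%:R :> R by rewrite ler1n.
    by have := halpha j; lra.
  by move=> x xs; apply/andP; split; [exact: path_lt_mem s0 xs|exact: (allP s1)].
move=> b2 b1 h1.
have {}K0 : (-1) ^+ n / \prod_(j < r) pochhammer (n%:R + alpha j + beta + 1) (nn j) != 0.
  apply: K0 => j; have aj := halpha j.
  have [n1|] := eqVneq n 1%N; first by rewrite n1; have := h1 n1 j; lra.
  move=> n1; have : 2 <= n%:R :> R by rewrite (ler_nat _ 2) ltn_neqAle eq_sym n1.
  lra.
(* All steps but the last one are covered by [jp_iter_roots] at [beta + 1]. *)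
have : size (jp_shifts nn alpha) = n by exact: size_jp_shifts.
have hmem := @mem_jp_shifts _ _ nn alpha.
case: (jp_shifts nn alpha) cs0 hmem => [|c cs] /=.
  by move=> _ _ n00; rewrite -n00 in n0.
case/andP=> c0 cs0 hmem scs.
have [||a [s [a0 ss s0 s1 ->]]] := jp_iter_roots cs (beta + 1) => //.
  lra.
have [|||||a' [y [s' [a'0 y1 s'0 s'1 E]]]] := jp_step_roots_le0 (beta + 1) c s => //.
- lra.
- rewrite ss; case: cs {cs0 ss} scs hmem => [|c' cs] /= scs hmem.
    have [j cj] := hmem c (mem_head _ _).
    have := h1 (esym scs) j; lra.
  have : 0 <= (size cs)%:R :> R by rewrite ler0n.
  rewrite -natr1; lra.
exists y, s'; rewrite jp_stepZ E !scalerA; split; last split=> //.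
  apply: (zeros_with_mult_scale_prod _ (y :: s')).
  by apply: mulf_neq0 a'0; apply: mulf_neq0 K0 a0.
by move=> x xs; apply/andP; split; [exact: path_lt_mem s'0 xs|exact: (allP s'1)].
Qed.
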